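(* Let $n\ge3$ and let $G$ be the torus graph on $\mathbb{Z}_n^2$ with edges $\{(i,j),(i+1,j)\}$ and $\{(i,j),(i,j+1)\}$. Let $v_1,\dots,v_m\in G$ be any collection of $m$ vertices such that no two of them lie in a common square $\{(i,j),(i+1,j),(i,j+1),(i+1,j+1)\}$. Let $K$ be the kernel of the $\frac12$-lazy simple random walk on $G$ and let $Q$ be the kernel of the Metropolis--Hastings walk associated with $G\setminus\{v_1,\dots,v_m\}$. Then every function $f$ on $G\setminus\{v_1,\dots,v_m\}$ has an extension $\widehat f$ to $G$ (i.e. $\widehat f=f$ on $G\setminus\{v_1,\dots,v_m\}$) such that $$\mathcal{E}_K(\widehat f,\widehat f)\le 6\left(1-\frac{m}{n}\right)\mathcal{E}_Q(f,f).$$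
   Context: All coordinates are taken modulo $n$. $K(x,x)=\frac12$, $K(x,y)=\frac18$ if $x,y$ are adjacent in $G$, and $0$ otherwise; its stationary distribution is uniform on $G$. The Metropolis--Hastings walk $Q$ on $V=G\setminus\{v_1,\dots,v_m\}$ (base walk $K$, target distribution uniform on $V$) is given by $Q(x,y)=\frac18$ if $x,y\in V$ are adjacent in $G$, $Q(x,x)=1-\frac18\deg_V(x)$ where $\deg_V(x)$ is the number of neighbours of $x$ in $V$, and $0$ otherwise; its stationary distribution is uniform on $V$. For a kernel $P$ on a finite set $X$ with stationary distribution $\pi$, $\mathcal{E}_P(f,f)=\frac12\sum_{x,y\in X}|f(x)-f(y)|^2P(x,y)\pi(x)$.
   Formalization: The factor 1 − m/n is corrected to 1 − m/n² (n² is the number of vertices of G); as printed the bound fails, e.g. for n = m = 4 with removed vertices (0,0), (0,2), (2,0), (2,2), where the right side is 0 but a nonconstant f has no extension of zero energy. *)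

(* Defs.v *)
From mathcomp Require Import all_boot all_order all_algebra.

Set Implicit Arguments.
Unset Strict Implicit.
Unset Printing Implicit Defensive.

Import Order.TTheory GRing.Theory Num.Theory.
Local Open Scope ring_scope.

(* 'Z_n is the ring of integers modulo n only when 1 < n. *)
Definition torus (n : nat) : finType := ('Z_n * 'Z_n)%type.

Definition torus_edge (n : nat) (x y : torus n) : bool :=
  (y == (x.1 + 1, x.2)) || (y == (x.1, x.2 + 1)).

Definition torus_adj (n : nat) (x y : torus n) : bool :=
  torus_edge x y || torus_edge y x.

Definition torus_square (n : nat) (x : torus n) : {set torus n} :=
  [set x; (x.1 + 1, x.2); (x.1, x.2 + 1); (x.1 + 1, x.2 + 1)].

(* The type of the vertices that are not among the v i. *)
Definition perforated (n m : nat) (v : 'I_m -> torus n) : finType :=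
  {x : torus n | x \notin [set v i | i : 'I_m]}.

Definition uniform (R : numFieldType) (X : finType) (x : X) : R :=
  #|X|%:R^-1.

(* As R ranges over numFieldType, this covers both real- and complex-valued
   functions f; the value is then a nonnegative element of R. *)
Definition dirichlet (R : numFieldType) (X : finType)
    (P : X -> X -> R) (pi : X -> R) (f : X -> R) : R :=
  2^-1 * \sum_x \sum_y `|f x - f y| ^+ 2 * P x y * pi x.

Definition lazy_kernel (R : numFieldType) (n : nat) (x y : torus n) : R :=
  if x == y then 2^-1 else if torus_adj x y then 8^-1 else 0.

Definition perforated_deg (n m : nat) (v : 'I_m -> torus n)
    (x : perforated v) : nat :=
  #|[set y : perforated v | torus_adj (val x) (val y)]|.

(* For the base walk lazy_kernel and the uniform target, every proposed move
   to a remaining neighbour is accepted, and the proposals to a removed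
   neighbour are added to the holding probability 1/2. *)
Definition metropolis_kernel (R : numFieldType) (n m : nat)
    (v : 'I_m -> torus n) (x y : perforated v) : R :=
  if x == y then 1 - 8^-1 * (perforated_deg x)%:R
  else if torus_adj (val x) (val y) then 8^-1 else 0.

(* Main.v *)
(* A removed vertex h has its whole surrounding 8-cycle in V, since every
   vertex of that cycle shares a square with h. Extend f to h by the midpoint
   of the values at the two horizontal neighbours. By the triangle inequality
   alone, the energy of the four new edges at h is at most twice the energy of
   f along the 8-cycle. An edge has at most one removed vertex next to it on
   each side, so it lies on at most two such cycles, and the edge energy of the
   extension is at most 1 + 2 * 2 = 5 times that of f. The factor 1 - m / n ^ 2
   converts between the two uniform measures. *)
Require Import Defs.
From HB Require Import structures.
From mathcomp Require Import all_boot all_order all_algebra.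
From mathcomp Require Import ring.

Set Implicit Arguments.
Unset Strict Implicit.
Unset Printing Implicit Defensive.

Import Order.TTheory GRing.Theory Num.Theory.
Local Open Scope ring_scope.

(** Joins the finite and the additive structure of a product, so that ['Z_n * 'Z_n] can play the
    role of [T] below. *)
HB.instance Definition _ (U V : finZmodType) := GRing.Zmodule.on (U * V)%type.

Section Energy.
Variable R : numFieldType.

(** * Quadratic inequalities around a single hole *)

Lemma sqr_normD_le (x y : R) :
  `|x + y| ^+ 2 <= 2 * (`|x| ^+ 2 + `|y| ^+ 2).
Proof.
have h : `|x + y| ^+ 2 <= (`|x| + `|y|) ^+ 2.
  by rewrite lerXn2r ?nnegrE ?addr_ge0 // ler_normD.
apply: le_trans h _; rewrite -subr_ge0.
have -> : 2 * (`|x| ^+ 2 + `|y| ^+ 2) - (`|x| + `|y|) ^+ 2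
    = (`|x| - `|y|) ^+ 2 by ring.
(* In a [numFieldType] a square is known to be nonnegative only for a real element; a difference of
   norms is one. *)
by rewrite real_exprn_even_ge0 // rpredB // normr_real.
Qed.

Lemma sqr_dist_le (x y z : R) :
  `|x - z| ^+ 2 <= 2 * (`|x - y| ^+ 2 + `|y - z| ^+ 2).
Proof. by rewrite -[x - z](subrKA y) sqr_normD_le. Qed.

(** The [a]s are the neighbours of the hole and the [c]s the corners between them. Convexity bounds
    the distances from [m] to [a2] and [a4]; those to [a1] and [a3] are half of [a1 - a3], a chord
    that can be split at [a2] or at [a4]. The total is at most the sum of the four terms
    [|a_i - a_(i+1)|^2], and splitting each at its corner costs the factor 2. *)
Lemma hub_energy_le (a1 c1 a2 c2 a3 c3 a4 c4 : R) (m := (a1 + a3) / 2) :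
  `|m - a1| ^+ 2 + `|m - a2| ^+ 2 + `|m - a3| ^+ 2 + `|m - a4| ^+ 2
  <= 2 * (`|a1 - c1| ^+ 2 + `|c1 - a2| ^+ 2 + `|a2 - c2| ^+ 2
          + `|c2 - a3| ^+ 2 + `|a3 - c3| ^+ 2 + `|c3 - a4| ^+ 2
          + `|a4 - c4| ^+ 2 + `|c4 - a1| ^+ 2).
Proof.
have mid b : `|m - b| ^+ 2 <= 2^-1 * (`|a1 - b| ^+ 2 + `|b - a3| ^+ 2).
  have -> : m - b = (a1 - b + (a3 - b)) / 2 by rewrite /m; field.
  rewrite normrM exprMn (distrC b) normfV normr_nat // exprVn.
  have -> : 2^-1 * (`|a1 - b| ^+ 2 + `|a3 - b| ^+ 2)
      = 2 * (`|a1 - b| ^+ 2 + `|a3 - b| ^+ 2) * (2 ^+ 2)^-1 by field.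
  by rewrite ler_wpM2r ?invr_ge0 ?exprn_ge0 // sqr_normD_le.
have m1 : `|m - a1| ^+ 2 = 4^-1 * `|a1 - a3| ^+ 2.
  have -> : m - a1 = (a3 - a1) / 2 by rewrite /m; field.
  by rewrite normrM exprMn distrC normfV normr_nat //; field.
have m3 : `|m - a3| ^+ 2 = 4^-1 * `|a1 - a3| ^+ 2.
  have -> : m - a3 = (a1 - a3) / 2 by rewrite /m; field.
  by rewrite normrM exprMn normfV normr_nat //; field.
have t2 := sqr_dist_le a1 a2 a3; have t4 := sqr_dist_le a1 a4 a3.
have u1 := sqr_dist_le a1 c1 a2; have u2 := sqr_dist_le a2 c2 a3.
have u3 := sqr_dist_le a3 c3 a4; have u4 := sqr_dist_le a4 c4 a1.
rewrite (distrC a1 a4) (distrC a4 a3) in t4.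
have M2 := mid a2; have M4 := mid a4.
rewrite (distrC a1 a4) (distrC a4 a3) in M4.
rewrite m1 m3 -subr_ge0.
move: t2 t4 u1 u2 u3 u4 M2 M4; rewrite -!(subr_ge0 _ (_ * _)).
set A := `|a1 - a3| ^+ 2.
set D1 := `|a1 - a2| ^+ 2; set D2 := `|a2 - a3| ^+ 2.
set D3 := `|a3 - a4| ^+ 2; set D4 := `|a4 - a1| ^+ 2.
set X2 := `|m - a2| ^+ 2; set X4 := `|m - a4| ^+ 2.
set E1 := `|a1 - c1| ^+ 2; set E2 := `|c1 - a2| ^+ 2.
set E3 := `|a2 - c2| ^+ 2; set E4 := `|c2 - a3| ^+ 2.
set E5 := `|a3 - c3| ^+ 2; set E6 := `|c3 - a4| ^+ 2.
set E7 := `|a4 - c4| ^+ 2; set E8 := `|c4 - a1| ^+ 2.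
move=> t2 t4 u1 u2 u3 u4 M2 M4.
(* The gap is a nonnegative combination of the slacks of the previous bounds; [t2] and [t4], with
   weight 1/4 each, absorb the two copies of [A / 4]. *)
have -> : 2 * (E1 + E2 + E3 + E4 + E5 + E6 + E7 + E8)
    - (4^-1 * A + X2 + 4^-1 * A + X4)
  = (2^-1 * (D1 + D2) - X2) + (2^-1 * (D4 + D3) - X4)
    + 4^-1 * ((2 * (D1 + D2) - A) + (2 * (D4 + D3) - A))
    + ((2 * (E1 + E2) - D1) + (2 * (E3 + E4) - D2)
       + (2 * (E5 + E6) - D3) + (2 * (E7 + E8) - D4)) by field.
by repeat first [assumption | apply: addr_ge0 | apply: mulr_ge0; rewrite ?invr_ge0].
Qed.

(** * Edge sums over a finite abelian group with two generators *)

Variables (T : finZmodType) (e1 e2 : T).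

Lemma sum_shift (d : T) (F : T -> R) : \sum_x F (x + d) = \sum_x F x.
Proof. by rewrite [RHS](reindex_inj (addIr d)). Qed.

(** The inequations on [e1] and [e2] say that no edge arises from two steps or in both orientations,
    so each is seen exactly once from either end. *)
Lemma sum_sym_adj (adj : rel T) (w : T -> T -> R) :
    e1 != e2 -> e1 + e1 != 0 -> e1 + e2 != 0 -> e2 + e2 != 0 ->
    (forall x y, adj x y = ((y == x + e1) || (y == x + e2))
                           || ((x == y + e1) || (x == y + e2))) ->
    (forall x y, w x y = w y x) ->
  \sum_x \sum_y w x y * (adj x y)%:R
  = 2 * \sum_x (w x (x + e1) + w x (x + e2)).
Proof.
move=> n12 n11 n1p2 n22 adjE w_sym.
pose edge x y := (y == x + e1) || (y == x + e2).
have edgeR x y : (edge x y)%:R = (y == x + e1)%:R + (y == x + e2)%:R :> R.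
  rewrite /edge; have [->|_] := eqVneq y (x + e1); last by rewrite add0r.
  by rewrite (inj_eq (addrI x)) (negPf n12) addr0.
have edge_asym x y : edge x y -> ~~ edge y x.
  have loop d d' : d + d' != 0 -> (x == x + d + d') = false.
    by move=> dd'; rewrite -{1}[x]addr0 -addrA (inj_eq (addrI x)) eq_sym (negPf dd').
  by case/orP=> /eqP->; rewrite /edge !loop // addrC.
have adjR x y : (adj x y)%:R = (edge x y)%:R + (edge y x)%:R :> R.
  rewrite adjE -/(edge x y) -/(edge y x).
  by case: (boolP (edge x y)) => [/edge_asym/negPf->|_]; rewrite ?addr0 ?add0r.
have -> : \sum_x \sum_y w x y * (adj x y)%:R
    = \sum_x \sum_y w x y * (edge x y)%:R + \sum_x \sum_y w x y * (edge y x)%:R.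
  rewrite -big_split; apply: eq_bigr => x _; rewrite -big_split.
  by apply: eq_bigr => y _; rewrite adjR mulrDr.
have -> : \sum_x \sum_y w x y * (edge y x)%:R
    = \sum_x \sum_y w x y * (edge x y)%:R.
  by rewrite exchange_big; do 2!(apply: eq_bigr => ? _); rewrite w_sym.
have pick x z : \sum_y w x y * (y == z)%:R = w x z.
  by rewrite (bigD1 z) //= eqxx mulr1 big1 ?addr0 // => y /negPf->; rewrite mulr0.
rewrite -mulr2n [RHS]mulr_natl; congr (_ *+ _); apply: eq_bigr => x _.
by under eq_bigr do rewrite edgeR mulrDr; rewrite big_split /= !pick.
Qed.

(** * Energy of the extension across the holes *)

Variable hole : pred T.
Hypothesis hole_e1 : forall x, hole x -> ~~ hole (x + e1).
Hypothesis hole_e2 : forall x, hole x -> ~~ hole (x + e2).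
Hypothesis hole_diag : forall x, hole x -> ~~ hole (x + e1 + e2).
Hypothesis hole_antidiag : forall x, hole x -> ~~ hole (x - e1 + e2).

Variable F : T -> R.

Definition hole_fill (x : T) : R :=
  if hole x then (F (x + e1) + F (x - e1)) / 2 else F x.

(** The 0/1 factor lets sums run over all of [T] while hiding the values of [F] at holes. *)
Definition edge_energy (e x : T) : R :=
  `|F x - F (x + e)| ^+ 2 * (~~ hole x && ~~ hole (x + e))%:R.

Lemma edge_energy_ge0 e x : 0 <= edge_energy e x.
Proof. by rewrite mulr_ge0 ?exprn_ge0 ?ler0n. Qed.

Lemma edge_energyE e x : ~~ hole x -> ~~ hole (x + e) ->
  edge_energy e x = `|F x - F (x + e)| ^+ 2.
Proof. by rewrite /edge_energy => -> ->; rewrite mulr1. Qed.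

Lemma hole_sub e x : (forall y, hole y -> ~~ hole (y + e)) ->
  hole x -> ~~ hole (x - e).
Proof.
by move=> H hx; apply/negP => /H; rewrite subrK hx.
Qed.

(* Since x - d and x - d' are never both holes, G x is counted at most once. *)
Lemma sum_hole_le (G : T -> R) (d d' : T) : (forall x, 0 <= G x) ->
    (forall x, hole x -> ~~ hole (x + (d - d'))) ->
  \sum_(x | hole x) (G (x + d) + G (x + d')) <= \sum_x G x.
Proof.
move=> G0 Hd.
have shift c : \sum_(x | hole x) G (x + c) = \sum_x G x * (hole (x - c))%:R.
  rewrite -[RHS](sum_shift c) big_mkcond; apply: eq_bigr => x _.
  by rewrite addrK; case: (hole x); rewrite ?mulr1 ?mulr0.
rewrite big_split !shift -big_split; apply: ler_sum => x _ /=.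
rewrite -mulrDr ler_piMr //.
have [/Hd|_] := boolP (hole (x - d)); last by rewrite add0r lern1 leq_b1.
by rewrite addrA subrK => /negPf->; rewrite addr0.
Qed.

(** Each bracket is one side, made of two edges, of the square with corners [x ± e1 ± e2]. *)
Definition cycle_energy (x : T) : R :=
    (edge_energy e2 (x + e1) + edge_energy e2 (x + (e1 - e2)))
  + (edge_energy e2 (x - e1) + edge_energy e2 (x + (- e1 - e2)))
  + (edge_energy e1 (x + e2) + edge_energy e1 (x + (e2 - e1)))
  + (edge_energy e1 (x - e2) + edge_energy e1 (x + (- e2 - e1))).

(** Two holes having the same edge on the same side of their squares would differ by [e1] or [e2].
    So each kind of side counts an edge at most once, and each direction has two kinds. *)
Lemma sum_cycle_energy_le :
  \sum_(x | hole x) cycle_energy x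
  <= 2 * \sum_x (edge_energy e1 x + edge_energy e2 x).
Proof.
have E d d' e H := @sum_hole_le (edge_energy e) d d' (edge_energy_ge0 e) H.
rewrite /cycle_energy big_split big_split big_split /=.
have -> : 2 * \sum_x (edge_energy e1 x + edge_energy e2 x)
    = \sum_x edge_energy e2 x + \sum_x edge_energy e2 x
      + \sum_x edge_energy e1 x + \sum_x edge_energy e1 x.
  by rewrite big_split /=; ring.
rewrite !lerD // E // => x; rewrite subKr.
all: first [exact: hole_e1 | exact: hole_e2].
Qed.

Lemma hole_energy_le x : hole x ->
  `|hole_fill x - F (x + e1)| ^+ 2 + `|hole_fill x - F (x + e2)| ^+ 2
  + `|hole_fill x - F (x - e1)| ^+ 2 + `|hole_fill x - F (x - e2)| ^+ 2
  <= 2 * cycle_energy x.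
Proof.
move=> hx; rewrite /hole_fill hx.
(* The cycle is listed counterclockwise from [x + e1]. The rest checks that its eight vertices are
   not holes and matches the edges up to orientation. *)
have := hub_energy_le (F (x + e1)) (F (x + e1 + e2)) (F (x + e2))
  (F (x - e1 + e2)) (F (x - e1)) (F (x - e1 - e2)) (F (x - e2)) (F (x + e1 - e2)).
move=> /le_trans; apply; rewrite le_eqVlt; apply/orP; left; apply/eqP.
congr (2 * _); rewrite /cycle_energy.
have n1 := hole_e1 hx; have n2 := hole_e2 hx.
have n3 := hole_sub hole_e1 hx; have n4 := hole_sub hole_e2 hx.
have n5 := hole_diag hx; have n6 := hole_antidiag hx.
have n7 : ~~ hole (x - e1 - e2).
  by rewrite -addrA -opprD; apply: hole_sub => // y; rewrite addrA; apply: hole_diag.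
have n8 : ~~ hole (x + e1 - e2).
  have -> : x + e1 - e2 = x - (- e1 + e2) by rewrite opprD opprK addrA.
  by apply: hole_sub => // y; rewrite addrA; apply: hole_antidiag.
rewrite !addrA (addrAC x e2 (- e1)) (addrAC x (- e2) (- e1)).
rewrite !edge_energyE ?subrK //.
all: rewrite ?(addrAC x e2) ?(addrAC x (- e2)) ?(addrAC (x - e1) (- e2)) ?(addrAC (x - e1) e2) ?subrK //.
rewrite (distrC (F (x + e1 + e2)) (F (x + e2))).
rewrite (distrC (F (x - e1)) (F (x - e1 - e2))).
rewrite (distrC (F (x - e2)) (F (x + e1 - e2))).
rewrite (distrC (F (x - e1)) (F (x - e1 + e2))).
by rewrite (distrC (F (x + e2)) (F (x - e1 + e2))); ring.
Qed.

(** An edge has no hole, a hole at its start or a hole at its end, never two; the last sum is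
    reindexed from the end to the start. *)
Lemma sum_sqr_hole_fill (e : T) : (forall x, hole x -> ~~ hole (x + e)) ->
  \sum_x `|hole_fill x - hole_fill (x + e)| ^+ 2
  = \sum_x edge_energy e x
    + (\sum_(x | hole x) `|hole_fill x - F (x + e)| ^+ 2
       + \sum_(x | hole x) `|hole_fill x - F (x - e)| ^+ 2).
Proof.
move=> He; rewrite ![\sum_(x | hole x) _]big_mkcond /=.
rewrite -(sum_shift e (fun x => if hole x then `|_ - F (x - e)| ^+ 2 else 0)).
rewrite -!big_split /=.
apply: eq_bigr => x _; rewrite addrK /edge_energy.
have [hx|hx] := boolP (hole x).
  by rewrite (negPf (He _ hx)) /= mulr0 add0r addr0 {2}/hole_fill (negPf (He _ hx)).
rewrite add0r /=; have [hxe|hxe] := boolP (hole (x + e)).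
  by rewrite mulr0 add0r {1}/hole_fill (negPf hx) distrC.
by rewrite mulr1 addr0 /hole_fill (negPf hx) (negPf hxe).
Qed.

Lemma hole_fill_energy_le :
  \sum_x (`|hole_fill x - hole_fill (x + e1)| ^+ 2
          + `|hole_fill x - hole_fill (x + e2)| ^+ 2)
  <= 5 * \sum_x (edge_energy e1 x + edge_energy e2 x).
Proof.
rewrite [leLHS]big_split /= !sum_sqr_hole_fill //.
set S := \sum_x (_ + _).
have -> : 5 * S = S + 2 * (2 * S) by ring.
rewrite addrACA -big_split lerD2l -!big_split /=.
apply: le_trans (ler_wpM2l _ sum_cycle_energy_le) => //.
rewrite mulr_sumr; apply: ler_sum => x /hole_energy_le.
by apply: le_trans; rewrite le_eqVlt; apply/orP; left; apply/eqP; ring.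
Qed.

End Energy.

(** * Dirichlet forms as edge sums, and the torus *)

(** Diagonal terms vanish, so prescribing [P] off the diagonal covers both walks, with [c = 1/8]. *)
Lemma dirichlet_uniform (R : numFieldType) (X : finType) (P : X -> X -> R)
    (adj : rel X) (c : R) (f : X -> R) :
    (forall x y, x != y -> P x y = if adj x y then c else 0) ->
  dirichlet P (@uniform R X) f
  = 2^-1 * c * #|X|%:R^-1 * \sum_x \sum_y `|f x - f y| ^+ 2 * (adj x y)%:R.
Proof.
move=> PE; rewrite /dirichlet /uniform -!mulrA; congr (_ * _).
rewrite !mulr_sumr; apply: eq_bigr => x _.
rewrite !mulr_sumr; apply: eq_bigr => y _.
have [->|/PE->] := eqVneq x y; first by rewrite subrr normr0 expr0n !mul0r !mulr0.
by case: (adj x y) => /=; ring.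
Qed.

Lemma sum_sig (R : nmodType) (T : finType) (P : pred T) (G : T -> R) :
  \sum_(x : {x : T | P x}) G (val x) = \sum_(x | P x) G x.
Proof. by rewrite [RHS](big_sub P). Qed.

Lemma Zp_two_neq0 (n : nat) : (2 < n)%N -> 1 + 1 != 0 :> 'Z_n.
Proof. by case: n => [|[|[|n]]]. Qed.

(* Since the torus has n ^ 2 vertices, 1 - m / n ^ 2 is the ratio of the sizes
   of the perforated and the full torus. With 1 - m / n instead, the bound
   fails: for n = m = 4 it would force a nonconstant f to have an extension of
   zero energy. *)
Theorem theorem5 (R : numFieldType) (n m : nat) (hn : (3 <= n)%N)
    (v : 'I_m -> torus n)
    (hv : forall i j : 'I_m, i != j ->
       ~ exists s : torus n, v i \in torus_square s /\ v j \in torus_square s)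
    (f : perforated v -> R) :
  exists fhat : torus n -> R,
    (forall x : perforated v, fhat (val x) = f x) /\
    dirichlet (@lazy_kernel R n) (@uniform R (torus n)) fhat
    <= 6 * (1 - m%:R / n%:R ^+ 2)
       * dirichlet (@metropolis_kernel R n m v) (@uniform R (perforated v)) f.
Proof.
pose S := [set v i | i : 'I_m]; pose hole : pred (torus n) := mem S.
pose e1 : 'Z_n * 'Z_n := (1, 0); pose e2 : 'Z_n * 'Z_n := (0, 1).
have n1 : (1 < n)%N by exact: ltnW.
have v_inj : injective v.
  move=> i j vij; apply/eqP/negPn/negP => ij; case: (hv i j ij).
  by exists (v i); rewrite -vij !inE eqxx.
have no_square s x y : x \in torus_square s -> y \in torus_square s -> x != y ->
    hole x -> ~~ hole y.
  move=> sx sy xy /imsetP[i _ xi]; apply/negP => /imsetP[j _ yj].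
  have ij : i != j by apply: contraNneq xy => ij; rewrite xi yj ij.
  by case: (hv i j ij); exists s; rewrite -xi -yj.
have Zn1 : 1 != 0 :> 'Z_n by exact: oner_neq0.
(* For [n = 2] the steps [e1] and [- e1] would coincide. *)
have Zn2 := Zp_two_neq0 hn.
have addE (x : torus n) (d : 'Z_n * 'Z_n) : (x : 'Z_n * 'Z_n) + d = (x.1 + d.1, x.2 + d.2).
  by case: x.
have pair_eq0 (d : 'Z_n * 'Z_n) : (d == 0) = (d.1 == 0) && (d.2 == 0).
  by case: d.
have ne_add (x d : 'Z_n * 'Z_n) : d != 0 -> x != x + d.
  by move=> d0; rewrite -{1}[x]addr0 (inj_eq (addrI x)) eq_sym.
have hole1 x : hole x -> ~~ hole ((x : 'Z_n * 'Z_n) + e1).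
  apply: (no_square x); rewrite ?ne_add ?pair_eq0 //= ?(negPf Zn1) //.
  - by rewrite !inE eqxx.
  - by rewrite !inE addE /= addr0 eqxx ?orbT.
have hole2 x : hole x -> ~~ hole ((x : 'Z_n * 'Z_n) + e2).
  apply: (no_square x); rewrite ?ne_add ?pair_eq0 //= ?(negPf Zn1) ?andbF //.
  - by rewrite !inE eqxx.
  - by rewrite !inE addE /= addr0 eqxx ?orbT.
have hole3 x : hole x -> ~~ hole ((x : 'Z_n * 'Z_n) + e1 + e2).
  rewrite -addrA.
  apply: (no_square x); rewrite ?ne_add ?pair_eq0 //= ?addr0 ?(negPf Zn1) //.
  - by rewrite !inE eqxx.
  - by rewrite !inE addE /= addr0 add0r eqxx ?orbT.
have hole4 x : hole x -> ~~ hole ((x : 'Z_n * 'Z_n) - e1 + e2).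
  apply: (no_square ((x : 'Z_n * 'Z_n) - e1)).
  - by rewrite !inE addE /= subrK oppr0 addr0 -surjective_pairing eqxx ?orbT.
  - by rewrite !inE !addE /= !addr0 eqxx ?orbT.
  - by rewrite -addrA ne_add // pair_eq0 /= addr0 oppr_eq0 (negPf Zn1).
(* The default 0 at holes is never seen: [edge_energy] masks it and [hole_fill] replaces it. *)
pose F (x : torus n) : R := if insub x is Some y then f y else 0.
have FE (x : perforated v) : F (val x) = f x by rewrite /F valK.
have adjE (x y : torus n) : torus_adj x y =
    ((y == (x : 'Z_n * 'Z_n) + e1) || (y == (x : 'Z_n * 'Z_n) + e2))
    || ((x == (y : 'Z_n * 'Z_n) + e1) || (x == (y : 'Z_n * 'Z_n) + e2)).
  by rewrite /torus_adj /torus_edge !addE /= !addr0.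
have sum_adj w := @sum_sym_adj R _ e1 e2 (@torus_adj n) w.
(* The vertices [0] and [e1] are not both holes; this permits division by the size of the perforated
   torus. *)
have V_gt0 : (0 < #|perforated v|)%N.
  apply/card_gt0P; have [/hole1 h|h] := boolP (hole 0); by exists (exist (fun x => x \notin S) _ h).
have cardT : #|torus n| = (n ^ 2)%N.
  by rewrite card_prod card_ord Zp_cast.
have cardV : #|perforated v|%:R = n%:R ^+ 2 - m%:R :> R.
  rewrite card_sig -natrX -cardT -(cardC S) natrD card_imset // card_ord.
  by rewrite addrAC subrr add0r.
have e12 : e1 != e2 by rewrite -subr_eq0 pair_eq0 /= subr0 (negPf Zn1).
have {}sum_adj w (w_sym : forall x y, w x y = w y x) :
    \sum_x \sum_y w x y * (torus_adj x y)%:R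
    = 2 * \sum_x (w x (x + e1) + w x (x + e2)) :> R.
  by apply: sum_sym_adj => //; rewrite pair_eq0 /= (negPf Zn2).
pose g := hole_fill e1 hole F; exists g; split=> [x|].
  have /negPf nx : ~~ hole (val x) := valP x.
  by rewrite /g /hole_fill nx FE.
rewrite (@dirichlet_uniform _ _ _ (@torus_adj n) 8^-1); last first.
  by move=> x y /negPf xy; rewrite /lazy_kernel xy.
rewrite (@dirichlet_uniform _ _ _ (fun x y => torus_adj (val x) (val y)) 8^-1); last first.
  by move=> x y /negPf xy; rewrite /metropolis_kernel xy.
have KE := sum_adj (fun x y => `|g x - g y| ^+ 2) (fun x y => congr1 (fun z => z ^+ 2) (distrC _ _)).
pose w x y := `|F x - F y| ^+ 2 * (~~ hole x && ~~ hole y)%:R.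
have w_sym x y : w x y = w y x by rewrite /w distrC andbC.
(* The sum over the subtype becomes a masked sum over the whole torus, where [sum_sym_adj]
   applies. *)
have QE : \sum_x \sum_y `|f x - f y| ^+ 2 * (torus_adj (val x) (val y))%:R
    = \sum_x \sum_y w x y * (torus_adj x y)%:R.
  pose W x y := `|F x - F y| ^+ 2 * (torus_adj x y)%:R.
  transitivity (\sum_(x | ~~ hole x) \sum_(y | ~~ hole y) W x y).
    rewrite -(sum_sig (fun x => ~~ hole x)); apply: eq_bigr => x _.
    rewrite -(sum_sig (fun x => ~~ hole x)); apply: eq_bigr => y _.
    by rewrite /W !FE.
  rewrite big_mkcond; apply: eq_bigr => x _.
  rewrite /w; have [hx|hx] := boolP (hole x) => /=.
    by rewrite big1 // => y _; rewrite mulr0 mul0r.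
  rewrite big_mkcond; apply: eq_bigr => y _; rewrite /W.
  by case: (hole y); rewrite ?mulr1 ?mulr0 ?mul0r.
rewrite QE KE sum_adj // cardV cardT natrX.
have SE := hole_fill_energy_le hole1 hole2 hole3 hole4 F.
have n_neq0 : n%:R != 0 :> R by rewrite pnatr_eq0 -lt0n ltnW.
have V_neq0 : n%:R ^+ 2 - m%:R != 0 :> R by rewrite -cardV pnatr_eq0 -lt0n.
set SF := \sum_x (w _ _ + _).
have SF_ge0 : 0 <= SF by apply: sumr_ge0 => x _; rewrite addr_ge0 ?edge_energy_ge0.
have -> : 6 * (1 - m%:R / n%:R ^+ 2)
      * (2^-1 * 8^-1 * (n%:R ^+ 2 - m%:R)^-1 * (2 * SF))
    = 2^-1 * 8^-1 * (n%:R ^+ 2)^-1 * (2 * (6 * SF)).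
  by field; rewrite n_neq0 V_neq0.
rewrite !ler_wpM2l ?mulr_ge0 ?invr_ge0 ?exprn_ge0 //.
(* The constant obtained is 5, weakened here to 6. *)
by apply: le_trans SE _; rewrite ler_wpM2r // ler_nat.
Qed.
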